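(* Let $D\subsetneq\mathbb{R}^n$ be a domain and $x,y\in D$. Then $$2\tilde\tau_D(x,y)\le u_D(x,y)\le 4\tilde\tau_D(x,y).$$ Both inequalities are sharp, i.e. the constant $2$ cannot be replaced by a larger constant, and the constant $4$ cannot be replaced by a smaller constant, so that the corresponding inequality remains valid for all domains $D\subsetneq\mathbb{R}^n$ and all $x,y\in D$.
   Context: Here $n\ge2$, a domain is an open connected nonempty set, the boundary $\partial D$ is taken in $\mathbb{R}^n$ and $d(x)=\mathrm{dist}(x,\partial D)$. For $x,y\in D$, $$\tilde\tau_D(x,y)=\log\left(1+\sup_{p\in\partial D}\frac{|x-y|}{\sqrt{|x-p||p-y|}}\right),\qquad u_D(x,y)=2\log\frac{|x-y|+\max\{d(x),d(y)\}}{\sqrt{d(x)d(y)}}.$$ *)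

(* Defs.v *)
From mathcomp Require Import all_boot all_order all_algebra.
From mathcomp Require Import all_classical all_reals all_analysis.

Set Implicit Arguments.
Unset Strict Implicit.
Unset Printing Implicit Defensive.

Import Order.TTheory GRing.Theory Num.Theory.
Import numFieldNormedType.Exports.

Local Open Scope classical_set_scope.
Local Open Scope ring_scope.

(* The library norm on 'rV[R]_n is the max norm.  It induces the usual topology
   of R^n, which is what open, connected, closure and interior refer to below,
   but distances have to be measured with the Euclidean metric. *)
Definition eucl_dist {R : realType} {n : nat} (x y : 'rV[R]_n) : R :=
  Num.sqrt (\sum_(i < n) (x ord0 i - y ord0 i) ^+ 2).

Definition is_domain {R : realType} {n : nat} (D : set 'rV[R]_n) : Prop :=
  [/\ open D, connected D & D !=set0].

Definition is_proper_domain {R : realType} {n : nat} (D : set 'rV[R]_n) : Prop :=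
  is_domain D /\ D `<` setT.

Definition boundary {R : realType} {n : nat} (D : set 'rV[R]_n) : set 'rV[R]_n :=
  closure D `\` interior D.

Definition dist_boundary {R : realType} {n : nat} (D : set 'rV[R]_n)
    (x : 'rV[R]_n) : R :=
  inf [set eucl_dist x p | p in boundary D].

(* The real-valued inf and sup are 0 on sets that are empty or unbounded on the
   relevant side.  This does not occur for a proper domain D and x, y in D: the
   boundary is then nonempty, and |x-p| >= d(x) > 0, |p-y| >= d(y) > 0 on it. *)
Definition tau_tilde {R : realType} {n : nat} (D : set 'rV[R]_n)
    (x y : 'rV[R]_n) : R :=
  ln (1 + sup [set eucl_dist x y / Num.sqrt (eucl_dist x p * eucl_dist p y)
              | p in boundary D]).

Definition u_metric {R : realType} {n : nat} (D : set 'rV[R]_n)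
    (x y : 'rV[R]_n) : R :=
  2 * ln ((eucl_dist x y + Num.max (dist_boundary D x) (dist_boundary D y))
          / Num.sqrt (dist_boundary D x * dist_boundary D y)).

(* Main.v *)
(** Write a = d(x) <= b = d(y), t = |x-y| and let S be the supremum in the
    definition of tau.  Since |x-p| >= a and |p-y| >= b on the boundary,
    1 + S <= 1 + t/sqrt(ab) <= (t+b)/sqrt(ab), which is the lower inequality.
    A boundary point p nearest to x has |p-y| <= a + t, so that
    S >= t/sqrt(a(a+t)); together with a <= b <= a + t this gives
    (t+b)/sqrt(ab) <= (1+S)^2, which is the upper inequality.
    Both constants are sharp in a half-space, for two points at height 1 and
    mutual distance t: u/tau tends to 2 as t -> 0 and to 4 as t -> oo. *)

Require Import Defs.
From mathcomp Require Import all_boot all_order all_algebra.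
From mathcomp Require Import all_classical all_reals all_analysis.
From mathcomp Require Import ring lra.

Set Implicit Arguments.
Unset Strict Implicit.
Unset Printing Implicit Defensive.

Import Order.TTheory GRing.Theory Num.Theory.
Import numFieldNormedType.Exports.

Local Open Scope classical_set_scope.
Local Open Scope ring_scope.

(** * Preliminaries: connectedness of convex sets and the Cauchy-Schwarz inequality *)

(** A nonempty [A] is the union of the segments from one fixed point to all others; these are
    continuous images of [[0, 1]] with a common point. It is applied to the whole space and to the
    half-space. *)
Lemma convex_connected (R : realType) (V : normedModType R) (A : set V) :
  (forall x y t, A x -> A y -> 0 <= t <= 1 -> A (x + t *: (y - x))) ->
  connected A.
Proof.
move=> Acvx; have [->|/set0P[x Ax]] := eqVneq A set0; first exact: connected0.
pose seg (y : V) : set V := (fun t : R => x + t *: (y - x)) @` `[0, 1].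
have -> : A = \bigcup_(y in A) seg y.
  apply/seteqP; split => [y Ay|_ [y Ay [s s01 <-]]].
    by exists y => //; exists 1; rewrite ?scale1r ?subrKC//= in_itv/= ler01 lexx.
  by move: s01; rewrite /= in_itv; exact: Acvx.
apply: bigcup_connected => [|y Ay].
  exists x => y Ay; exists 0; last by rewrite scale0r addr0.
  by rewrite /= in_itv/= lexx ler01.
apply: connected_continuous_connected; first exact: segment_connected.
apply: continuous_subspaceT => t.
by apply: cvgD; [exact: cvg_cst|apply: cvgZl; exact: cvg_id].
Qed.

(** Cauchy-Schwarz, from expanding the nonnegative sum of the squares of [a * v i - b * u i] into
    [a * (a * c - b ^+ 2)] and cancelling [a > 0]. *)
Lemma sum_mul_sqr_le (R : realType) (I : finType) (u v : I -> R) :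
  (\sum_i u i * v i) ^+ 2 <= (\sum_i u i ^+ 2) * (\sum_i v i ^+ 2).
Proof.
set a := \sum_i u i ^+ 2; set b := \sum_i u i * v i; set c := \sum_i v i ^+ 2.
have a_ge0 : 0 <= a by apply: sumr_ge0 => i _; exact: sqr_ge0.
have [a0|a_neq0] := eqVneq a 0.
  suff -> : b = 0 by rewrite a0 mul0r expr0n.
  apply: big1 => i _; have /eqP := a0.
  rewrite psumr_eq0; last by move=> j _; exact: sqr_ge0.
  move=> /allP/(_ i); rewrite mem_index_enum => /(_ isT).
  by rewrite /= sqrf_eq0 => /eqP ->; rewrite mul0r.
have a_gt0 : 0 < a by rewrite lt_def a_neq0.
have : 0 <= \sum_i (a * v i - b * u i) ^+ 2.
  by apply: sumr_ge0 => i _; exact: sqr_ge0.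
have -> : \sum_i (a * v i - b * u i) ^+ 2 = a * (a * c - b ^+ 2).
  transitivity (\sum_i (a ^+ 2 * v i ^+ 2 - 2 * a * b * (u i * v i)
                        + b ^+ 2 * u i ^+ 2)).
    by apply: eq_bigr => i _; ring.
  rewrite big_split sumrB -!mulr_sumr /= -/a -/c -/b.
  by ring.
by rewrite pmulr_rge0// subr_ge0.
Qed.

(** * The Euclidean metric and its comparison with the max norm *)

Section EuclDist.
Variables (R : realType) (n : nat).
Implicit Types (x y z : 'rV[R]_n) (D : set 'rV[R]_n).

Lemma eucl_dist_ge0 x y : 0 <= eucl_dist x y.
Proof. exact: sqrtr_ge0. Qed.

Lemma eucl_distC x y : eucl_dist x y = eucl_dist y x.
Proof. by congr Num.sqrt; apply: eq_bigr => i _; ring. Qed.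

Lemma sqr_eucl_dist x y :
  eucl_dist x y ^+ 2 = \sum_(i < n) (x ord0 i - y ord0 i) ^+ 2.
Proof. by rewrite sqr_sqrtr//; apply: sumr_ge0 => i _; exact: sqr_ge0. Qed.

Lemma ler_eucl_distD y x z : eucl_dist x z <= eucl_dist x y + eucl_dist y z.
Proof.
rewrite -(@ler_pXn2r _ 2) ?nnegrE ?addr_ge0 ?eucl_dist_ge0//.
rewrite sqrrD !sqr_eucl_dist.
set u := fun i => x ord0 i - y ord0 i; set v := fun i => y ord0 i - z ord0 i.
have -> : \sum_i (x ord0 i - z ord0 i) ^+ 2 =
    \sum_i u i ^+ 2 + (\sum_i u i * v i) *+ 2 + \sum_i v i ^+ 2.
  rewrite -sumrMnl -!big_split /=; apply: eq_bigr => i _.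
  by rewrite /u /v; ring.
rewrite lerD2r lerD2l lerMn2r /= -sqrtrM; last first.
  by apply: sumr_ge0 => i _; exact: sqr_ge0.
by rewrite (le_trans (ler_norm _))// -sqrtr_sqr ler_wsqrtr// sum_mul_sqr_le.
Qed.

Lemma ler_coord_eucl_dist x y i : `|x ord0 i - y ord0 i| <= eucl_dist x y.
Proof.
rewrite -sqrtr_sqr ler_wsqrtr// (bigD1 i)//= lerDl.
by apply: sumr_ge0 => j _; exact: sqr_ge0.
Qed.

(** [ball] belongs to the max norm, which the Euclidean distance dominates; this links the topology
    to Euclidean distances. *)
Lemma ball_eucl_dist x y e : 0 < e -> eucl_dist x y < e -> ball x e y.
Proof.
move=> e0 xye; split => // i j.
rewrite ord1.
by apply: le_lt_trans xye; exact: ler_coord_eucl_dist.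
Qed.

End EuclDist.

(** * Distance to the boundary and the supremum in [tau_tilde] *)

Section Boundary.
Variables (R : realType) (n : nat).
Implicit Types (x y z p : 'rV[R]_n) (D : set 'rV[R]_n).

Lemma boundary_open D p : open D -> boundary D p -> ~ D p.
Proof. by move=> /interior_id DD [_]; rewrite DD. Qed.

(** With empty boundary, [D] would be clopen, and [D] and its complement would separate the
    connected whole space. *)
Lemma proper_domain_boundary D : is_proper_domain D -> boundary D !=set0.
Proof.
move=> [[Do _ [x Dx]] [_ nTD]].
apply/set0P/negP => /eqP /seteqP[bD _].
have clD : closed D.
  rewrite closure_id; apply/seteqP; split; first exact: subset_closure.
  move=> p cDp; apply: contrapT => nDp.
  by apply: (bD p); split=> //; rewrite (interior_id D).1.
have /connected_subset cT : separated D (~` D).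
  by apply/clopen_separatedP; split.
have : connected [set: 'rV[R]_n] by exact: convex_connected.
by move=> /cT[|//|/(_ x I)//]; rewrite setUv.
Qed.

Lemma dist_boundary_le D x p : boundary D p ->
  dist_boundary D x <= eucl_dist x p.
Proof.
move=> bp; apply: ge_inf; last by exists p.
by exists 0 => _ [q _ <-]; exact: eucl_dist_ge0.
Qed.

Lemma le_dist_boundary D x e : boundary D !=set0 ->
  (forall p, boundary D p -> e <= eucl_dist x p) -> e <= dist_boundary D x.
Proof.
move=> [p bp] H; apply: lb_le_inf; first by exists (eucl_dist x p), p.
by move=> _ [q bq <-]; exact: H.
Qed.

(** Some ball around [x] lies in the open set [D], whereas boundary points lie outside [D]. *)
Lemma dist_boundary_gt0 D x : is_proper_domain D -> D x ->
  0 < dist_boundary D x.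
Proof.
move=> Ddom Dx; have [[Do _ _] _] := Ddom.
have /nbhs_ballP[e e0 eD] : nbhs x D by exact: open_nbhs_nbhs.
apply: (lt_le_trans e0); apply: le_dist_boundary.
  exact: proper_domain_boundary.
move=> p bp; rewrite leNgt; apply/negP => /(ball_eucl_dist e0)/eD.
exact: boundary_open.
Qed.

Lemma dist_boundary_lipschitz D x y : boundary D !=set0 ->
  dist_boundary D y <= dist_boundary D x + eucl_dist x y.
Proof.
move=> bD; rewrite -lerBlDr; apply: le_dist_boundary => // p bp.
rewrite lerBlDl eucl_distC (le_trans (dist_boundary_le _ bp))//.
exact: ler_eucl_distD.
Qed.

Definition tau_sup D x y : R :=
  sup [set eucl_dist x y / Num.sqrt (eucl_dist x p * eucl_dist p y)
      | p in boundary D].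

Lemma tau_tildeE D x y : tau_tilde D x y = ln (1 + tau_sup D x y).
Proof. by []. Qed.

(** A bound uniform in [p]: it makes [tau_sup] a genuine supremum and also yields the lower
    inequality. *)
Lemma boundary_quotient_le D x y p : is_proper_domain D -> D x -> D y ->
  boundary D p ->
  eucl_dist x y / Num.sqrt (eucl_dist x p * eucl_dist p y) <=
  eucl_dist x y / Num.sqrt (dist_boundary D x * dist_boundary D y).
Proof.
move=> Ddom Dx Dy bp.
have dx := dist_boundary_gt0 Ddom Dx.
have dy := dist_boundary_gt0 Ddom Dy.
have xp := dist_boundary_le x bp.
have yp := dist_boundary_le y bp; rewrite eucl_distC in yp.
rewrite ler_wpM2l ?eucl_dist_ge0// lef_pV2 ?posrE ?sqrtr_gt0 ?mulr_gt0//.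
- by rewrite ler_wsqrtr// ler_pM// ltW.
- exact: lt_le_trans xp.
- exact: lt_le_trans yp.
Qed.

Lemma tau_sup_le D x y s : boundary D !=set0 ->
  (forall p, boundary D p ->
    eucl_dist x y / Num.sqrt (eucl_dist x p * eucl_dist p y) <= s) ->
  tau_sup D x y <= s.
Proof.
move=> [p bp] H; apply: ge_sup; last by move=> _ [q bq <-]; exact: H.
by eexists; exists p; first exact: bp.
Qed.

Lemma le_tau_sup D x y p : is_proper_domain D -> D x -> D y -> boundary D p ->
  eucl_dist x y / Num.sqrt (eucl_dist x p * eucl_dist p y) <= tau_sup D x y.
Proof.
move=> Ddom Dx Dy bp; apply: ub_le_sup; last by exists p.
exists (eucl_dist x y / Num.sqrt (dist_boundary D x * dist_boundary D y)).
by move=> _ [q bq <-]; exact: boundary_quotient_le.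
Qed.

Lemma tau_sup_ge0 D x y : is_proper_domain D -> D x -> D y ->
  0 <= tau_sup D x y.
Proof.
move=> Ddom Dx Dy; have [p bp] := proper_domain_boundary Ddom.
apply: le_trans (le_tau_sup Ddom Dx Dy bp).
by rewrite divr_ge0 ?eucl_dist_ge0 ?sqrtr_ge0.
Qed.

Lemma tau_supC D x y : tau_sup D x y = tau_sup D y x.
Proof.
congr sup; apply/seteqP; split => _ [p bp <-]; exists p => //;
by rewrite (eucl_distC y x) (eucl_distC y p) (eucl_distC p x) [eucl_dist p y * _]mulrC.
Qed.

Lemma u_metricC D x y : u_metric D x y = u_metric D y x.
Proof. by rewrite /u_metric eucl_distC maxC [dist_boundary D y * _]mulrC. Qed.

(* As d(x) is only an infimum, the inequality t^2 <= S^2 r (r + t), valid for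
   every r = |x-p|, is solved for r before passing to the infimum. *)
Lemma tau_sup_sqr D x y : is_proper_domain D -> D x -> D y ->
  eucl_dist x y ^+ 2 <=
  tau_sup D x y ^+ 2 * (dist_boundary D x * (dist_boundary D x + eucl_dist x y)).
Proof.
move=> Ddom Dx Dy; set t := eucl_dist x y; set S := tau_sup D x y.
have bD := proper_domain_boundary Ddom.
have dx := dist_boundary_gt0 Ddom Dx.
have dy := dist_boundary_gt0 Ddom Dy.
have t_ge0 : 0 <= t by exact: eucl_dist_ge0.
have S_ge0 : 0 <= S by exact: tau_sup_ge0.
have tS p : boundary D p -> t ^+ 2 <= S ^+ 2 * (eucl_dist x p * (eucl_dist x p + t)).
  move=> bp.
  have xp0 : 0 < eucl_dist x p by exact: lt_le_trans (dist_boundary_le _ bp).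
  have yp0 : 0 < eucl_dist p y.
    by rewrite eucl_distC; exact: lt_le_trans (dist_boundary_le _ bp).
  have := le_tau_sup Ddom Dx Dy bp.
  rewrite ler_pdivrMr ?sqrtr_gt0 ?mulr_gt0// -/t -/S.
  rewrite -(@ler_pXn2r _ 2) ?nnegrE ?mulr_ge0 ?sqrtr_ge0//.
  rewrite exprMn [Num.sqrt (_ * _) ^+ 2]sqr_sqrtr ?mulr_ge0 ?(ltW xp0) ?(ltW yp0)// => /le_trans.
  apply; rewrite ler_wpM2l ?sqr_ge0// ler_pM2l//.
  by rewrite /t [eucl_dist x p]eucl_distC ler_eucl_distD.
have [t0|t_neq0] := eqVneq t 0.
  by rewrite t0 expr0n mulr_ge0 ?sqr_ge0// mulr_ge0 ?addr_ge0// ltW.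
have t_gt0 : 0 < t by rewrite lt_def t_neq0.
have S_gt0 : 0 < S.
  rewrite lt_def S_ge0 andbT; apply/eqP => S0.
  have [p /tS] := bD; rewrite S0 expr0n mul0r leNgt exprn_gt0//.
have S2 : 0 < S ^+ 2 by rewrite exprn_gt0.
(* Completing the square: [r * (r + t) = (r + t / 2) ^+ 2 - (t / 2) ^+ 2], so for [r >= 0] the
   inequality reads [Num.sqrt K - t / 2 <= r]. *)
set K := t ^+ 2 / S ^+ 2 + (t / 2) ^+ 2.
have K_ge0 : 0 <= K by rewrite addr_ge0 ?divr_ge0 ?sqr_ge0.
have : Num.sqrt K - t / 2 <= dist_boundary D x.
  apply: le_dist_boundary => // p /tS tSp.
  rewrite lerBlDr -(@ler_pXn2r _ 2) ?nnegrE ?sqrtr_ge0 ?addr_ge0 ?divr_ge0 ?eucl_dist_ge0//.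
  rewrite sqr_sqrtr//.
  have : t ^+ 2 / S ^+ 2 <= eucl_dist x p * (eucl_dist x p + t).
    by rewrite ler_pdivrMr// mulrC.
  rewrite /K; lra.
rewrite lerBlDr -(@ler_pXn2r _ 2) ?nnegrE ?sqrtr_ge0 ?addr_ge0 ?divr_ge0 ?(ltW dx)//.
rewrite sqr_sqrtr// => h.
by rewrite mulrC -ler_pdivrMr//; move: h; rewrite /K; lra.
Qed.

End Boundary.

(* With a, b, c the square roots of d(x), d(y), d(x) + |x-y|.  By
   (b - a)(b - c) <= 0 the term b^2 is at most an affine function of b, so the
   claim reduces to the endpoints b = a and b = c. *)
Lemma u_tau_algebraic_bound (R : realType) (a b c s : R) :
  0 < a -> a <= b -> b <= c -> 0 <= s -> c ^+ 2 - a ^+ 2 <= s * (a * c) ->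
  c ^+ 2 - a ^+ 2 + b ^+ 2 <= a * b * (1 + s) ^+ 2.
Proof.
move=> a0 ab bc s0; set P := c ^+ 2 - a ^+ 2 => Ps.
have [b0 c0] : 0 < b /\ 0 < c by split; lra.
have P_ge0 : 0 <= P by rewrite /P; nra.
have ac0 : 0 < a * c by rewrite mulr_gt0.
have sq : (a * c + P) ^+ 2 <= (a * c * (1 + s)) ^+ 2.
  have le_acs : a * c + P <= a * c * (1 + s).
    by rewrite mulrDr mulr1 lerD2l mulrC.
  by rewrite ler_pXn2r ?nnegrE// ?(le_trans _ le_acs)// addr_ge0// ltW.
(* The claim for the smallest admissible [s], namely [P / (a * c)], with denominators cleared; [sq]
   carries it over to larger [s]. *)
have F : a * c ^+ 2 * (P + b ^+ 2) <= b * (a * c + P) ^+ 2.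
  have [ac|ac] := eqVneq a c.
    have -> : b = a by lra.
    by rewrite /P -ac; lra.
  have ca : 0 < c - a by rewrite subr_gt0 lt_def eq_sym ac; lra.
  have b2 : b ^+ 2 <= (a + c) * b - a * c by nra.
  (* [Q] is the difference of the two sides of [F] after replacing [b ^+ 2] by its affine bound, so
     its value at [b] is a convex combination of [Q a] and [Q c]. *)
  pose Q x := x * (a * c + P) ^+ 2 - a * c ^+ 2 * (P - a * c + (a + c) * x).
  have Qa : 0 <= Q a.
    have -> : Q a = a ^+ 2 * (c - a) * (a * c + P + c ^+ 2) by rewrite /Q /P; ring.
    apply: mulr_ge0; first by rewrite pmulr_rge0 ?exprn_gt0// ltW.
    by apply: addr_ge0; [apply: addr_ge0 => //; exact: ltW|exact: sqr_ge0].
  have Qc : 0 <= Q c.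
    have -> : Q c = c * (c - a) * (c ^+ 3 - a ^+ 3 + c ^+ 2 * a).
      by rewrite /Q /P; ring.
    rewrite pmulr_rge0 ?mulr_gt0// addr_ge0//; last first.
      by rewrite pmulr_rge0 ?exprn_gt0// ltW.
    by rewrite subr_ge0 lerXn2r ?nnegrE; lra.
  have : 0 <= Q b.
    rewrite -(pmulr_rge0 _ ca).
    have -> : (c - a) * Q b = (c - b) * Q a + (b - a) * Q c by rewrite /Q; ring.
    by rewrite addr_ge0// mulr_ge0// subr_ge0.
  rewrite /Q subr_ge0 => /(le_trans _); apply.
  by rewrite ler_wpM2l ?mulr_ge0 ?sqr_ge0 ?(ltW a0)//; lra.
rewrite -(ler_pM2l (_ : 0 < a * c ^+ 2)) ?mulr_gt0 ?exprn_gt0//.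
apply: (le_trans F); apply: (@le_trans _ _ (b * (a * c * (1 + s)) ^+ 2)).
  by rewrite ler_wpM2l// ltW.
by rewrite le_eqVlt; apply/orP; left; apply/eqP; ring.
Qed.

(** * The two inequalities between [tau_tilde] and [u_metric] *)

Section Comparison.
Variables (R : realType) (n : nat).
Implicit Types (x y z p : 'rV[R]_n) (D : set 'rV[R]_n).

Lemma tau_le_u D x y : is_proper_domain D -> D x -> D y ->
  2 * tau_tilde D x y <= u_metric D x y.
Proof.
move=> Ddom Dx Dy.
have bD := proper_domain_boundary Ddom.
have dx := dist_boundary_gt0 Ddom Dx.
have dy := dist_boundary_gt0 Ddom Dy.
set a := dist_boundary D x in dx *; set b := dist_boundary D y in dy *.
rewrite ler_pM2l// tau_tildeE -/a -/b.
have s0 : 0 < Num.sqrt (a * b) by rewrite sqrtr_gt0 mulr_gt0.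
have m0 : 0 < Num.max a b by rewrite lt_max dx.
have S1 : 0 < 1 + tau_sup D x y by rewrite ltr_wpDr// tau_sup_ge0.
rewrite ler_ln ?posrE ?S1 ?divr_gt0 ?ltr_wpDl ?eucl_dist_ge0//.
(* The fraction splits in two: the part with [eucl_dist x y] bounds the supremum, and the part with
   the maximum is at least 1, since a geometric mean is at most the maximum. *)
rewrite mulrDl addrC lerD//.
  by apply: tau_sup_le => // p; exact: boundary_quotient_le.
rewrite ler_pdivlMr// mul1r.
rewrite -[leRHS]ger0_norm ?(ltW m0)// -sqrtr_sqr ler_wsqrtr// expr2.
by rewrite ler_pM ?(ltW dx) ?(ltW dy)// le_max lexx ?orbT.
Qed.

Lemma u_le_tau_closer D x y : is_proper_domain D -> D x -> D y ->
  dist_boundary D x <= dist_boundary D y ->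
  u_metric D x y <= 4 * tau_tilde D x y.
Proof.
move=> Ddom Dx Dy ab.
have bD := proper_domain_boundary Ddom.
have dx := dist_boundary_gt0 Ddom Dx.
have dy := dist_boundary_gt0 Ddom Dy.
have bc := dist_boundary_lipschitz x y bD.
have tS := tau_sup_sqr Ddom Dx Dy.
rewrite /u_metric tau_tildeE (max_idPr ab).
set a := dist_boundary D x in dx ab bc tS *.
set b := dist_boundary D y in dy ab bc *.
set t := eucl_dist x y in bc tS *; set S := tau_sup D x y in tS *.
have S_ge0 : 0 <= S by exact: tau_sup_ge0.
have t_ge0 : 0 <= t by exact: eucl_dist_ge0.
have s0 : 0 < Num.sqrt (a * b) by rewrite sqrtr_gt0 mulr_gt0.
have S1 : 0 < 1 + S by rewrite ltr_wpDr.
have -> : 4 * ln (1 + S) = 2 * ln ((1 + S) ^+ 2) by rewrite lnXn// -mulr_natr; ring.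
rewrite ler_pM2l// ler_ln ?posrE ?exprn_gt0 ?divr_gt0 ?(ltr_wpDl t_ge0 dy)//.
rewrite ler_pdivrMr// mulrC sqrtrM ?(ltW dx)//.
have at_ge0 : 0 <= a + t by rewrite addr_ge0// ltW.
have [a0 b0] := (ltW dx, ltW dy).
(* In terms of the square roots of [a], [b] and [a + t], this is the left side of
   [u_tau_algebraic_bound]. Its hypothesis [b <= c] is the Lipschitz bound [bc], and its last
   hypothesis is the square root of [tS]. *)
have -> : t + b = Num.sqrt (a + t) ^+ 2 - Num.sqrt a ^+ 2 + Num.sqrt b ^+ 2.
  by rewrite !sqr_sqrtr//; ring.
apply: u_tau_algebraic_bound; rewrite ?sqrtr_gt0 ?ler_wsqrtr//.
have -> : Num.sqrt (a + t) ^+ 2 - Num.sqrt a ^+ 2 = t.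
  by rewrite !sqr_sqrtr//; ring.
rewrite -sqrtrM// -[S]ger0_norm// -sqrtr_sqr -sqrtrM ?sqr_ge0//.
by rewrite -[leLHS]ger0_norm// -[leLHS]sqrtr_sqr ler_wsqrtr.
Qed.

Lemma u_le_tau D x y : is_proper_domain D -> D x -> D y ->
  u_metric D x y <= 4 * tau_tilde D x y.
Proof.
move=> Ddom Dx Dy.
have [ab|/ltW ba] := leP (dist_boundary D x) (dist_boundary D y).
  exact: u_le_tau_closer.
by rewrite u_metricC tau_tildeE tau_supC -tau_tildeE; exact: u_le_tau_closer.
Qed.

End Comparison.

(** * Sharpness of both constants in a half-space *)

Section HalfSpace.
Variables (R : realType) (m : nat).
Implicit Types (a b c d t : R) (p : 'rV[R]_m.+2).

Definition half_space : set 'rV[R]_m.+2 := [set x | 0 < x ord0 ord0].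

(** The first coordinate is the height over the boundary hyperplane; the default value 0 of the list
    lookup fills all coordinates after the second. *)
Definition plane_pt a b : 'rV[R]_m.+2 := \row_i [:: a; b]`_i.

Lemma plane_pt0 a b : plane_pt a b ord0 ord0 = a.
Proof. by rewrite mxE. Qed.

Lemma eucl_dist_plane_pt a b c d :
  eucl_dist (plane_pt a b) (plane_pt c d) = Num.sqrt ((a - c) ^+ 2 + (b - d) ^+ 2).
Proof.
rewrite /eucl_dist !big_ord_recl !mxE /= big1 ?addr0// => i _.
by rewrite !mxE /= !nth_nil subrr expr0n.
Qed.

Lemma half_space_open : open half_space.
Proof.
apply: (@open_comp _ _ (fun x : 'rV[R]_m.+2 => x ord0 ord0) [set r | 0 < r]).
  by move=> x _; exact: coord_continuous.
exact: open_gt.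
Qed.

Lemma half_space_boundary b : boundary half_space (plane_pt 0 b).
Proof.
split; last by move=> /interior_subset; rewrite /half_space /= plane_pt0 ltxx.
move=> B /nbhs_ballP[e /= e0 eB]; exists (plane_pt (e / 2) b); split.
  by rewrite /half_space /= plane_pt0 divr_gt0.
apply: eB; apply: ball_eucl_dist => //.
rewrite eucl_dist_plane_pt subrr sub0r sqrrN expr0n addr0 sqrtr_sqr.
by rewrite ger0_norm; lra.
Qed.

Lemma half_space_proper : is_proper_domain half_space.
Proof.
split; last first.
  split=> // /(_ (plane_pt 0 0) I).
  by rewrite /half_space /= plane_pt0 ltxx.
split; [exact: half_space_open| |by exists (plane_pt 1 0); rewrite /half_space /= plane_pt0].
apply: convex_connected => x y t; rewrite /half_space /= !mxE => x0 y0 /andP[t0 t1].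
nra.
Qed.

Lemma half_space_plane_pt a b : 0 < a -> half_space (plane_pt a b).
Proof. by move=> a0; rewrite /half_space /= plane_pt0. Qed.

(** The foot [plane_pt 0 b] of the perpendicular gives the upper bound. For the lower one, boundary
    points lie outside the open half-space, so their first coordinate is at most 0. *)
Lemma dist_half_space a b : 0 < a -> dist_boundary half_space (plane_pt a b) = a.
Proof.
move=> a0; apply/eqP; rewrite eq_le; apply/andP; split.
  apply: le_trans (dist_boundary_le _ (half_space_boundary b)) _.
  by rewrite eucl_dist_plane_pt subrr expr0n addr0 subr0 sqrtr_sqr gtr0_norm.
apply: le_dist_boundary; first by exists (plane_pt 0 0); exact: half_space_boundary.
move=> p /(boundary_open half_space_open)/negP; rewrite -leNgt => p0.
apply: le_trans (ler_coord_eucl_dist _ _ ord0).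
by rewrite plane_pt0 (le_trans _ (ler_norm _))//; lra.
Qed.

Lemma u_half_space t : 0 < t ->
  u_metric half_space (plane_pt 1 0) (plane_pt 1 t) = 2 * ln (1 + t).
Proof.
move=> t0; rewrite /u_metric !dist_half_space// maxxx mulr1 sqrtr1 divr1.
by rewrite eucl_dist_plane_pt subrr expr0n add0r sub0r sqrrN sqrtr_sqr gtr0_norm// addrC.
Qed.

(** The boundary point is the origin, the foot of the perpendicular from [plane_pt 1 0]; the
    quotient there is t over the fourth root of [1 + t ^+ 2]. *)
Lemma tau_sup_half_space_ge t : 0 < t ->
  t / (1 + t) <= tau_sup half_space (plane_pt 1 0) (plane_pt 1 t).
Proof.
move=> t0.
apply: le_trans (le_tau_sup half_space_proper (half_space_plane_pt _ _)
  (half_space_plane_pt _ _) (half_space_boundary 0)) => //.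
rewrite !eucl_dist_plane_pt !subrr !subr0 !sub0r !sqrrN !expr1n !expr0n add0r addr0.
rewrite sqrtr1 mul1r sqrtr_sqr (gtr0_norm t0).
rewrite ler_pM2l// lef_pV2 ?posrE ?sqrtr_gt0 ?addr_gt0 ?exprn_gt0//.
rewrite -[leRHS]ger0_norm ?addr_ge0 ?(ltW t0)// -sqrtr_sqr ler_wsqrtr//.
rewrite -[leRHS]ger0_norm ?sqr_ge0// -sqrtr_sqr ler_wsqrtr//.
nra.
Qed.

(** The distances from [p] to the two points are at least 1 and have sum at least [t], so their
    product is at least [t / 2]. *)
Lemma tau_sup_half_space_le t : 0 < t ->
  tau_sup half_space (plane_pt 1 0) (plane_pt 1 t) <= Num.sqrt (2 * t).
Proof.
move=> t0; set x := plane_pt 1 0; set y := plane_pt 1 t.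
have bD := proper_domain_boundary half_space_proper.
have xy : eucl_dist x y = t.
  by rewrite eucl_dist_plane_pt subrr expr0n add0r sub0r sqrrN sqrtr_sqr gtr0_norm.
apply: tau_sup_le => // p bp; rewrite xy.
have xp := dist_boundary_le x bp; rewrite dist_half_space// in xp.
have yp := dist_boundary_le y bp; rewrite dist_half_space// eucl_distC in yp.
have := ler_eucl_distD p x y; rewrite xy => txy.
have h : t <= 2 * (eucl_dist x p * eucl_dist p y) by nra.
have s0 : 0 < eucl_dist x p * eucl_dist p y by nra.
rewrite ler_pdivrMr ?sqrtr_gt0// -sqrtrM; last by lra.
rewrite -[leLHS]gtr0_norm// -sqrtr_sqr ler_wsqrtr//.
nra.
Qed.

Lemma half_space_sharp_lower c : 2 < c ->
  exists x y : 'rV[R]_m.+2, [/\ half_space x, half_space y &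
    u_metric half_space x y < c * tau_tilde half_space x y].
Proof.
(* This [t] satisfies [2 * (1 + 2 * t) < c], which is what the final comparison of [2 * t] with
   [c * (t / (1 + 2 * t))] requires. *)
move=> c2; pose t := (c - 2) / 8.
have t0 : 0 < t by rewrite /t; lra.
exists (plane_pt 1 0), (plane_pt 1 t); split; try exact: half_space_plane_pt.
rewrite u_half_space// tau_tildeE.
have hu : ln (1 + t) <= t by apply: le_ln1Dx; lra.
have ht : t / (1 + 2 * t) <= ln (1 + tau_sup half_space (plane_pt 1 0) (plane_pt 1 t)).
  (* The logarithm is bounded below by [1 - v^-1 <= ln v] at [v = (1 + 2 * t) / (1 + t) = 1 + t / (1
     + t)]. *)
  have v0 : 0 < (1 + 2 * t) / (1 + t) by rewrite divr_gt0; lra.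
  apply: (@le_trans _ _ (ln ((1 + 2 * t) / (1 + t)))).
    rewrite -[X in ln X]invrK lnV ?posrE ?invr_gt0// lerNr.
    have -> : ((1 + 2 * t) / (1 + t))^-1 = 1 + - (t / (1 + 2 * t)) by field; lra.
    apply: le_ln1Dx; rewrite ltrN2 ltr_pdivrMr; lra.
  rewrite ler_ln ?posrE//; last first.
    have : 0 < t / (1 + t) by rewrite divr_gt0//; lra.
    by have := tau_sup_half_space_ge t0; lra.
  have -> : (1 + 2 * t) / (1 + t) = 1 + t / (1 + t) by field; lra.
  by rewrite lerD2l tau_sup_half_space_ge.
apply: (@le_lt_trans _ _ (2 * t)); first by lra.
apply: (@lt_le_trans _ _ (c * (t / (1 + 2 * t)))); last by rewrite ler_pM2l; lra.
rewrite mulrA ltr_pdivlMr; last by lra.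
by rewrite mulrAC ltr_pM2r//; rewrite /t; lra.
Qed.

Lemma half_space_sharp_upper c : c < 4 ->
  exists x y : 'rV[R]_m.+2, [/\ half_space x, half_space y &
    c * tau_tilde half_space x y < u_metric half_space x y].
Proof.
(* With [t = 2 * s ^+ 2] the bound [Num.sqrt (2 * t)] becomes [2 * s]. Then [u_metric] is at least
   [4 * M] and [tau_tilde] at most [2 + M]; the choice of [M] gives [M * (4 - c) = 8 > 2 * c], hence
   [c * (2 + M) < 4 * M]. *)
move=> c4; pose M := 8 / (4 - c); pose s := expR M; pose t := 2 * s ^+ 2.
have d0 : 0 < 4 - c by lra.
have M0 : 0 < M by rewrite divr_gt0.
have s1 : 1 < s by rewrite expR_gt1.
have t0 : 0 < t by rewrite mulr_gt0// exprn_gt0; lra.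
exists (plane_pt 1 0), (plane_pt 1 t); split; try exact: half_space_plane_pt.
rewrite u_half_space// tau_tildeE.
set S := tau_sup _ _ _.
have S_ge0 : 0 <= S.
  by apply: tau_sup_ge0; [exact: half_space_proper| |]; exact: half_space_plane_pt.
have S_le : S <= 2 * s.
  apply: le_trans (tau_sup_half_space_le t0) _.
  have -> : 2 * t = (2 * s) ^+ 2 by rewrite /t; ring.
  by rewrite sqrtr_sqr ger0_norm//; lra.
have tau_ge0 : 0 <= ln (1 + S) by rewrite ln_ge0// lerDl.
have tau_le : ln (1 + S) <= 2 + M.
  apply: (@le_trans _ _ (ln (3 * s))).
    by rewrite ler_ln ?posrE; lra.
  rewrite lnM ?posrE; [|lra|lra].
  rewrite /s expRK lerD2r.
  have -> : 3 = 1 + 2 :> R by lra.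
  by apply: le_ln1Dx; lra.
have u_ge : 2 * M <= ln (1 + t).
  rewrite mulr_natl -[M]expRK -lnXn ?expR_gt0// -/s.
  rewrite ler_ln ?posrE ?exprn_gt0 /t; nra.
have Mc : M * (4 - c) = 8 by rewrite /M divfK// gt_eqF.
(* The bound [tau_le] can be multiplied by [c] only for positive [c]; otherwise the left side is at
   most 0 and the right side is positive. *)
have [c0|c0] := leP c 0; nra.
Qed.

End HalfSpace.

Theorem theorem4p5 (R : realType) (n : nat) (hn : (2 <= n)%N) :
  (forall (D : set 'rV[R]_n) (x y : 'rV[R]_n),
      is_proper_domain D -> D x -> D y ->
      2 * tau_tilde D x y <= u_metric D x y /\
      u_metric D x y <= 4 * tau_tilde D x y) /\
  (forall c : R, 2 < c ->
      ~ (forall (D : set 'rV[R]_n) (x y : 'rV[R]_n),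
          is_proper_domain D -> D x -> D y ->
          c * tau_tilde D x y <= u_metric D x y)) /\
  (forall c : R, c < 4 ->
      ~ (forall (D : set 'rV[R]_n) (x y : 'rV[R]_n),
          is_proper_domain D -> D x -> D y ->
          u_metric D x y <= c * tau_tilde D x y)).
Proof.
(* Writing the dimension as [m.+2] makes the half-space available, so sharpness holds in every fixed
   dimension, already within this one domain. *)
case: n hn => [//|[//|m]] _; split; [|split].
- by move=> D x y Ddom Dx Dy; split; [exact: tau_le_u|exact: u_le_tau].
- move=> c /(half_space_sharp_lower m)[x [y [Dx Dy ltc]]] H.
  by have := H _ _ _ (half_space_proper R m) Dx Dy; rewrite leNgt ltc.
- move=> c /(half_space_sharp_upper m)[x [y [Dx Dy ltc]]] H.
  by have := H _ _ _ (half_space_proper R m) Dx Dy; rewrite leNgt ltc.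
Qed.
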